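(* Let $\mathcal{B}$ be a building set on $[d]$. The nestohedron $\Delta_{\mathcal{B}}$ is inscribed if and only if for all $J\subseteq[d]$ the following holds: whenever $i,j,k\in J$ satisfy $n^k_{i,j}(\mathcal{B}|_J)>0$ and $n^i_{j,k}(\mathcal{B}|_J)>0$, then $n^k_{i,j}(\mathcal{B}|_J)=n^i_{j,k}(\mathcal{B}|_J)=n^j_{i,k}(\mathcal{B}|_J)$.
   Context: A building set is a collection $\mathcal{B}$ of subsets of $[d]=\{1,\dots,d\}$ such that $I\cap J\neq\emptyset$ implies $I\cup J\in\mathcal{B}$ for all $I,J\in\mathcal{B}$. For $I\subseteq[d]$, $\Delta_I=\mathrm{conv}(e_i:i\in I)$, and the nestohedron is the Minkowski sum $\Delta_{\mathcal{B}}=\sum_{I\in\mathcal{B}}\Delta_I$. For $i,j,k\in[d]$, $n^k_{i,j}(\mathcal{B})$ is the number of $I\in\mathcal{B}$ with $i,j\in I$ and $k\notin I$. The restriction is $\mathcal{B}|_J=\{I\in\mathcal{B}:I\subseteq J\}$. A polytope is inscribed if all its vertices lie on a common sphere. *)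

(* Defs.v *)
From HB Require Import structures.
From mathcomp Require Import all_boot all_order all_algebra.
From mathcomp Require Import reals.
Set Implicit Arguments. Unset Strict Implicit. Unset Printing Implicit Defensive.
Import Order.TTheory GRing.Theory Num.Theory.
Local Open Scope ring_scope.

Section Nesto.
Variables (R : realType) (d : nat).

Definition building_set (B : {set {set 'I_d}}) : Prop :=
  set0 \notin B /\
  (forall I J, I \in B -> J \in B -> I :&: J != set0 -> I :|: J \in B).

Definition conv (V : seq 'rV[R]_d) : 'rV[R]_d -> Prop :=
  fun x => exists w : 'I_(size V) -> R,
    (forall i, 0 <= w i) /\ \sum_i w i = 1 /\
    x = \sum_i w i *: V`_i.

Definition e_ (i : 'I_d) : 'rV[R]_d := delta_mx 0 i.

Definition simplexI (I : {set 'I_d}) : 'rV[R]_d -> Prop :=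
  conv [seq e_ i | i <- enum I].

Definition nestohedron (B : {set {set 'I_d}}) : 'rV[R]_d -> Prop :=
  fun x => exists f : {set 'I_d} -> 'rV[R]_d,
    (forall I, I \in B -> simplexI I (f I)) /\ x = \sum_(I in B) f I.

Definition is_vertex (P : 'rV[R]_d -> Prop) (v : 'rV[R]_d) : Prop :=
  P v /\ forall y z t, P y -> P z -> 0 < t -> t < 1 ->
    v = t *: y + (1 - t) *: z -> y = z.

Definition inscribed (P : 'rV[R]_d -> Prop) : Prop :=
  exists (c : 'rV[R]_d) (rho : R), forall v, is_vertex P v ->
    \sum_i (v 0 i - c 0 i) ^+ 2 = rho.

End Nesto.

Definition restrict d (B : {set {set 'I_d}}) (J : {set 'I_d}) : {set {set 'I_d}} :=
  [set I in B | I \subset J].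

Definition ncount d (B : {set {set 'I_d}}) (i j k : 'I_d) : nat :=
  #|[set I in B | (i \in I) && (j \in I) && (k \notin I)]|.

(* Main.v *)
(** Write [B|_J] for the restriction, [deg J i] for the number of its members
    containing [i], and [n_ij(J)] for the number containing both [i] and [j].
    The vertices of the nestohedron are the sums [\sum_(I in B) e_(top I)] over
    linear orders, whose coordinate at [x] is [deg J x] with [J] the set of
    elements not above [x].  Exchanging two consecutive elements [i], [j] of
    the order moves the vertex by [n_ij(J) (e_i - e_j)], so two such vertices
    are equidistant from [c] exactly when [n_ij(J) = 0] or
    [deg J i - deg J j = c_i - c_j].  Hence the nestohedron is inscribed with
    center [c] iff the latter holds whenever [n_ij(J) > 0].  Comparing this
    equation for [J] and [J :\ k] gives [n_ik(J) = n_jk(J)], which is the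
    stated condition; conversely that condition propagates the equation from
    [J] up to the ground set, and [c_i = deg setT i] works. *)
Require Import Defs.
From HB Require Import structures.
From mathcomp Require Import all_boot all_order all_algebra.
From mathcomp Require Import reals.
From mathcomp Require Import zify ring lra.
Import Order.TTheory GRing.Theory Num.Theory.
Local Open Scope ring_scope.

(** * Member counts of a set family and the equations for a center *)

Section Counting.
Set Implicit Arguments. Unset Strict Implicit.
Variables (d : nat) (B : {set {set 'I_d}}).
Implicit Types (I J K : {set 'I_d}) (i j k : 'I_d).

(** Sets [K] of size one, two and three give the degrees, the pair counts and the triple counts, so
    one splitting rule serves all of them. *)
Definition nsup J K : nat := #|[set I in restrict B J | K \subset I]|.

Definition deg J i : nat := nsup J [set i].

Lemma nsup_split J K k : nsup J K = (nsup (J :\ k) K + nsup J (k |: K))%N.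
Proof.
rewrite /nsup -(cardsID [set I : {set 'I_d} | k \in I]) addnC; congr (_ + _)%N.
  apply: eq_card => I; rewrite !inE subsetD1 -!andbA.
  by case: (I \in B); case: (I \subset J); case: (k \in I); case: (K \subset I).
apply: eq_card => I; rewrite !inE subUset sub1set -!andbA.
by case: (I \in B); case: (I \subset J); case: (k \in I); case: (K \subset I).
Qed.

Lemma ncount_nsup J i j k : ncount (restrict B J) i j k = nsup (J :\ k) [set i; j].
Proof.
apply: eq_card => I; rewrite !inE subsetD1 subUset !sub1set.
by case: (I \in B); case: (I \subset J); case: (k \in I); case: (i \in I); case: (j \in I).
Qed.

Lemma ncountC J i j k : ncount (restrict B J) i j k = ncount (restrict B J) j i k.
Proof. by rewrite !ncount_nsup setUC. Qed.

Lemma deg_split J i k : deg J i = (deg (J :\ k) i + nsup J [set i; k])%N.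
Proof. by rewrite /deg (nsup_split J _ k) setUC. Qed.

Lemma nsup2_split J i j k :
  nsup J [set i; j] = (ncount (restrict B J) i j k + nsup J (k |: [set i; j]))%N.
Proof. by rewrite ncount_nsup -nsup_split. Qed.

Lemma nsup3E J i j k :
  (nsup J (j |: [set i; k]) = nsup J (k |: [set i; j])) *
  (nsup J (i |: [set j; k]) = nsup J (k |: [set i; j])).
Proof.
split; congr nsup; apply/setP => x; rewrite !inE;
by case: (x == i); case: (x == j); case: (x == k).
Qed.

Lemma nsup_monoS J J' K : J \subset J' -> (nsup J K <= nsup J' K)%N.
Proof.
move=> sJ; apply: subset_leq_card; apply/subsetP => I; rewrite !inE.
by case/andP=> /andP[-> sI] ->; rewrite (subset_trans sI sJ).
Qed.

Definition balanced_triples : Prop := forall J i j k,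
  i \in J -> j \in J -> k \in J ->
  (0 < ncount (restrict B J) i j k)%N ->
  (0 < ncount (restrict B J) j k i)%N ->
  ncount (restrict B J) i j k = ncount (restrict B J) j k i /\
  ncount (restrict B J) j k i = ncount (restrict B J) i k j.

Definition potential (R : realType) (c : 'I_d -> R) : Prop := forall J i j,
  i \in J -> j \in J -> i != j -> (0 < nsup J [set i; j])%N ->
  (deg J i)%:R - (deg J j)%:R = c i - c j.

Lemma potential_balanced (R : realType) (c : 'I_d -> R) :
  potential c -> balanced_triples.
Proof.
move=> cP.
have step J i j k : i \in J -> j \in J -> k \in J ->
    (0 < ncount (restrict B J) i j k)%N ->
    ncount (restrict B J) i k j = ncount (restrict B J) j k i.
  move=> iJ jJ kJ; have [->|nij] := eqVneq i j; first by [].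
  move=> n0.
  have [I] : exists I, I \in [set I in restrict B J | (i \in I) && (j \in I) && (k \notin I)].
    by apply/set0Pn; rewrite -card_gt0.
  rewrite !inE => /andP[_ /andP[/andP[iI jI] kI]].
  have nik : i != k by apply: contraNneq kI => <-.
  have njk : j != k by apply: contraNneq kI => <-.
  have n1 := n0; rewrite ncount_nsup in n1.
  have iJk : i \in J :\ k by rewrite !inE nik.
  have jJk : j \in J :\ k by rewrite !inE njk.
  have e1 := cP _ _ _ iJk jJk nij n1.
  have e2 := cP _ _ _ iJ jJ nij (leq_trans n1 (nsup_monoS _ (subD1set J k))).
  (* Subtracting [e1] from [e2] equates the pair counts of [i], [k] and of [j], [k]; the members
     containing all three elements then cancel. *)
  move: e2; rewrite (deg_split J i k) (deg_split J j k) !natrD.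
  rewrite (nsup2_split J i k j) (nsup2_split J j k i) !(nsup3E J i j k) !natrD => e2.
  by apply/eqP; rewrite -(eqr_nat R); apply/eqP; lra.
move=> J i j k iJ jJ kJ h1 h2.
have e1 := step J i j k iJ jJ kJ h1.
have := step J j k i jJ kJ iJ h2.
rewrite (ncountC J j i k) (ncountC J k i j) => e2.
by rewrite e2 e1.
Qed.

Lemma balanced_potential (R : realType) :
  balanced_triples -> potential (fun i => (deg setT i)%:R : R).
Proof.
move=> bal J i j.
have [n] := ubnP #|~: J|; elim: n J => // n IH J leJ iJ jJ nij n0.
have [JT|] := eqVneq (~: J) set0.
  by rewrite -(setCK J) JT setC0.
case/set0Pn=> k; rewrite inE => kJ.
have kD : (k |: J) :\ k = J by rewrite setU1K.
rewrite -(IH (k |: J)) ?inE ?iJ ?jJ ?orbT //; first last.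
- by apply: leq_trans n0 (nsup_monoS _ (subsetUr _ _)).
- rewrite -ltnS; apply: leq_trans leJ; rewrite ltnS.
  apply: proper_card; rewrite properC setUC.
  by rewrite properE subsetUl; apply/subsetPn; exists k; rewrite ?inE ?eqxx ?orbT.
(* Adding [k] to [J] changes the difference of degrees by the pair count of [i], [k] minus that of
   [j], [k]; the members containing all three elements cancel. *)
rewrite (deg_split (k |: J) i k) (deg_split (k |: J) j k) kD !natrD.
rewrite (nsup2_split _ i k j) (nsup2_split _ j k i) !(nsup3E (k |: J) i j k).
have [ik jk kk] : [/\ i \in k |: J, j \in k |: J & k \in k |: J].
  by rewrite !inE iJ jJ eqxx !orbT.
have c1 : (0 < ncount (restrict B (k |: J)) i j k)%N by rewrite ncount_nsup kD.
suff -> : ncount (restrict B (k |: J)) i k j = ncount (restrict B (k |: J)) j k i.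
  by rewrite !natrD; ring.
(* If either count is positive, [bal] applies to it together with [c1]; otherwise both are zero. *)
have [z1|p1] := posnP (ncount (restrict B (k |: J)) j k i); last first.
  by case: (bal _ _ _ _ ik jk kk c1 p1).
have [->|p2] := posnP (ncount (restrict B (k |: J)) i k j); first by [].
rewrite ncountC in c1.
by case: (bal _ _ _ _ jk ik kk c1 p2).
Qed.

(** * Squared distances along linear orders *)

(** Removing [i] lowers the degree of [j] by the pair count [n], and symmetrically. With [a], [b]
    the offsets of the degrees in [J] from [c], the identity is [a^2 + (b - n)^2 - b^2 - (a - n)^2 =
    2n(a - b)]. *)
Lemma swap_sqr (R : realType) (c : 'I_d -> R) J i j :
  (((deg J i)%:R - c i) ^+ 2 + ((deg (J :\ i) j)%:R - c j) ^+ 2) -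
  (((deg J j)%:R - c j) ^+ 2 + ((deg (J :\ j) i)%:R - c i) ^+ 2) =
  2 * (nsup J [set i; j])%:R * (((deg J i)%:R - (deg J j)%:R) - (c i - c j)) :> R.
Proof.
rewrite (deg_split J i j) (deg_split J j i) (setUC [set j]) !natrD.
ring.
Qed.

(** For duplicate-free [s], read from the greatest element down, this is the part of the squared
    distance from [c] to the vertex of the order that comes from the coordinates in [s]. *)
Fixpoint order_sqdist (R : realType) (c : 'I_d -> R) (s : seq 'I_d) : R :=
  if s is x :: s' then ((deg [set y in s] x)%:R - c x) ^+ 2 + order_sqdist c s'
  else 0.

(** Adjacent exchanges connect all orders. When the heads differ, induction rearranges the tails
    until the lists are [x :: y :: l] and [y :: x :: l], and [swap_sqr] compares these. *)
Lemma order_sqdist_perm (R : realType) (c : 'I_d -> R) (s s' : seq 'I_d) :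
  potential c -> uniq s -> perm_eq s s' -> order_sqdist c s = order_sqdist c s'.
Proof.
move=> cP; have [n] := ubnP (size s).
elim: n s s' => // n IH [|x s] [|y s'] // le_n us pss;
  try by have := perm_size pss.
have eset : [set z in x :: s] = [set z in y :: s'].
  by apply/setP => z; rewrite !inE; have := perm_mem pss z; rewrite !inE.
have us' : uniq (y :: s') by rewrite -(perm_uniq pss).
have [exy|nxy] := eqVneq x y.
  subst y; rewrite /= eset (IH s s') //; first by case/andP: us.
  by rewrite -(perm_cons x).
have ys : y \in s.
  by have := perm_mem pss y; rewrite !inE eqxx eq_sym (negPf nxy).
pose l := rem y s.
have p1 : perm_eq s (y :: l) by exact: perm_to_rem.
have p2 : perm_eq s' (x :: l).
  rewrite -(perm_cons y) perm_sym; apply: perm_trans pss.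
  rewrite perm_sym (perm_trans (y := x :: y :: l)) ?perm_cons //.
  by apply/permP => a /=; rewrite addnCA.
have /andP[xs us1] := us; have /andP[ys' us1'] := us'.
have ss' : size s' = size s by have := perm_size pss; case.
have ss : (size s < n)%N by [].
have ss1 : (size s' < n)%N by rewrite ss'.
rewrite /= (IH s (y :: l)) // (IH s' (x :: l)) //= -eset.
set J := [set z in x :: s].
have -> : [set z in y :: l] = J :\ x.
  apply/setP => z; rewrite !inE -[(z == y) || _]/(z \in y :: l) -(perm_mem p1).
  by case: eqVneq => // ->; rewrite (negPf xs).
have -> : [set z in x :: l] = J :\ y.
  apply/setP => z; rewrite /J eset !inE -[(z == x) || _]/(z \in x :: l) -(perm_mem p2).
  by case: eqVneq => // ->; rewrite (negPf ys').
rewrite !addrA; congr (_ + _); apply/eqP; rewrite -subr_eq0 swap_sqr.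
have [->|n0] := posnP (nsup J [set x; y]); first by rewrite mulr0 mul0r.
by rewrite (cP _ _ _ _ _ nxy n0) ?subrr ?mulr0 // !inE ?eqxx ?ys ?orbT.
Qed.

(** Since the order is irrelevant, any [t] in [J] may be taken as the greatest element. *)
Lemma order_sqdist_peel (R : realType) (c : 'I_d -> R) J t :
  potential c -> t \in J ->
  order_sqdist c (enum J) = ((deg J t)%:R - c t) ^+ 2 + order_sqdist c (enum (J :\ t)).
Proof.
move=> cP tJ; rewrite (@order_sqdist_perm _ c _ (t :: enum (J :\ t))) ?enum_uniq //=.
  congr (((deg _ _)%:R - _) ^+ 2 + _); apply/setP => z.
  by rewrite !inE mem_enum !inE; case: eqVneq => [->|].
apply: uniq_perm; rewrite /= ?enum_uniq ?mem_enum ?inE ?eqxx //.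
by move=> z; rewrite !(inE, mem_enum); case: eqVneq => [->|].
Qed.

End Counting.

(** * Coordinates of points in simplices *)

Section Vertices.
Set Implicit Arguments. Unset Strict Implicit.
Variables (R : realType) (d : nat).
Implicit Types (I J C : {set 'I_d}) (B : {set {set 'I_d}}) (x y v : 'rV[R]_d).
Local Notation e := (@e_ R d).

Lemma e_E (i j : 'I_d) : e i 0 j = (i == j)%:R.
Proof. by rewrite mxE eqxx eq_sym. Qed.

Lemma sum_coord_e (i : 'I_d) : \sum_j e i 0 j = 1 :> R.
Proof.
rewrite (bigD1 i) //= e_E eqxx big1 ?addr0 // => j ji.
by rewrite e_E eq_sym (negPf ji).
Qed.

Lemma simplexIP I x :
  simplexI I x <->
  [/\ forall i, 0 <= x 0 i, forall i, i \notin I -> x 0 i = 0 & \sum_i x 0 i = 1].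
Proof.
rewrite /simplexI /conv size_map; split.
  have nI (k : 'I_(size (enum I))) :
      [seq e i | i <- enum I]`_k = e (tnth (in_tuple (enum I)) k).
    have k0 := tnth (in_tuple (enum I)) k.
    by rewrite (nth_map k0) // (tnth_nth k0).
  case=> w [w0 [w1 ->]].
  have cE i : (\sum_k w k *: [seq e i | i <- enum I]`_k) 0 i =
      \sum_k w k * (tnth (in_tuple (enum I)) k == i)%:R.
    by rewrite summxE; apply: eq_bigr => k _; rewrite nI mxE e_E.
  split=> [i|i iI|].
  - by rewrite cE; apply: sumr_ge0 => k _; rewrite mulr_ge0 ?ler0n.
  - rewrite cE big1 // => k _; case: eqP => [ki|]; rewrite ?mulr0 //.
    by move: iI; rewrite -ki -mem_enum mem_tnth.
  - rewrite (eq_bigr _ (fun i _ => cE i)) exchange_big /= -[RHS]w1.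
    apply: eq_bigr => k _; rewrite -mulr_sumr (bigD1 (tnth (in_tuple (enum I)) k)) //=.
    by rewrite eqxx big1 ?addr0 ?mulr1 // => i; rewrite eq_sym => /negPf->.
case=> x0 xI x1.
have reindexI (V : nmodType) (F : 'I_d -> V) :
    \sum_(k < size (enum I)) F (tnth (in_tuple (enum I)) k) = \sum_(i in I) F i.
  by rewrite -(big_tuple _ _ (in_tuple (enum I)) predT F) /= big_enum.
exists (fun k => x 0 (tnth (in_tuple (enum I)) k)); split=> //; split.
  rewrite (reindexI _ (fun i => x 0 i)) -[RHS]x1 [RHS](bigID (mem I)) /=.
  by rewrite [X in _ = _ + X]big1 ?addr0.
transitivity (\sum_(i in I) x 0 i *: e i).
  rewrite {1}(row_sum_delta x) (bigID (mem I)) /= [X in _ + X]big1 ?addr0 //.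
  by move=> i /xI ->; rewrite scale0r.
rewrite -reindexI; apply: eq_bigr => k _; congr (_ *: _).
have k0 := tnth (in_tuple (enum I)) k.
by rewrite (nth_map k0) // (tnth_nth k0).
Qed.

Lemma simplexI_e I i : i \in I -> simplexI I (e i).
Proof.
move=> iI; apply/simplexIP; split=> [j|j jI|]; last exact: sum_coord_e.
- by rewrite e_E ler0n.
- by rewrite e_E; case: eqP => // ij; rewrite -ij iI in jI.
Qed.

(** * Vertices obtained from linear orders *)

Lemma sum_e_E B (g : {set 'I_d} -> 'I_d) i :
  (\sum_(I in B) e (g I)) 0 i = #|[set I in B | g I == i]|%:R.
Proof.
rewrite summxE -sum1_card natr_sum big_mkcond [RHS]big_mkcond /=.
by apply: eq_bigr => I _; rewrite inE e_E; case: (I \in B); case: (g I == i).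
Qed.

(** The linear functional with weights [w] is maximal on each simplex only at [e (g I)], hence on
    the Minkowski sum only at the given point, and a unique maximizer is extreme. *)
Lemma maximal_sum_vertex B (w : 'I_d -> R) (g : {set 'I_d} -> 'I_d) :
  (forall I, I \in B -> g I \in I /\ forall i, i \in I -> i != g I -> w i < w (g I)) ->
  is_vertex (nestohedron B) (\sum_(I in B) e (g I)).
Proof.
move=> gP; pose phi x := \sum_i w i * x 0 i.
have phi_lin a b x y : phi (a *: x + b *: y) = a * phi x + b * phi y.
  rewrite /phi !mulr_sumr -big_split /=; apply: eq_bigr => i _.
  by rewrite !mxE; ring.
have phi_e i : phi (e i) = w i.
  rewrite /phi (bigD1 i) //= e_E eqxx mulr1 big1 ?addr0 // => j ji.
  by rewrite e_E eq_sym (negPf ji) mulr0.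
have phi_sum (f : {set 'I_d} -> 'rV[R]_d) : phi (\sum_(I in B) f I) = \sum_(I in B) phi (f I).
  rewrite /phi exchange_big /=; apply: eq_bigr => i _.
  by rewrite summxE mulr_sumr.
have gap I x : I \in B -> simplexI I x -> 
    w (g I) - phi x = \sum_i (w (g I) - w i) * x 0 i.
  move=> IB /simplexIP[_ _ x1]; rewrite -[X in X - _]mulr1 -x1 mulr_sumr -sumrB.
  by apply: eq_bigr => i _; rewrite mulrBl.
have term_ge0 I x i : I \in B -> simplexI I x -> 0 <= (w (g I) - w i) * x 0 i.
  move=> IB /simplexIP[x0 xI _]; have [_ gm] := gP _ IB.
  have [iI|/xI ->] := boolP (i \in I); last by rewrite mulr0.
  rewrite mulr_ge0 // subr_ge0; have [->//|/(gm _ iI)/ltW//] := eqVneq i (g I).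
have phi_le I x : I \in B -> simplexI I x -> phi x <= w (g I).
  by move=> IB sx; rewrite -subr_ge0 gap // sumr_ge0 // => i _; exact: term_ge0.
have phi_eq I x : I \in B -> simplexI I x -> phi x = w (g I) -> x = e (g I).
  move=> IB sx px; have /eqP := gap _ _ IB sx.
  rewrite px subrr eq_sym psumr_eq0 => [|i _]; last exact: term_ge0.
  move=> /allP x0; have [_ gm] := gP _ IB; have /simplexIP[_ xI x1] := sx.
  have xz i : i != g I -> x 0 i = 0.
    move=> ni; have [iI|/xI//] := boolP (i \in I).
    have := x0 i (mem_index_enum _); rewrite mulf_eq0 subr_eq0.
    by rewrite gt_eqF ?gm //= => /eqP.
  apply/rowP => i; rewrite e_E; have [<-|ni] := eqVneq (g I) i.
    by rewrite -[RHS]x1 (bigD1 (g I)) //= big1 ?addr0.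
  by rewrite xz // eq_sym.
pose M := \sum_(I in B) w (g I).
have P_le x : nestohedron B x -> phi x <= M.
  by case=> f [fP ->]; rewrite phi_sum ler_sum // => I IB; apply: phi_le => //; exact: fP.
have P_eq x : nestohedron B x -> phi x = M -> x = \sum_(I in B) e (g I).
  case=> f [fP ->]; rewrite phi_sum => /eqP; rewrite eq_sym -subr_eq0 -sumrB.
  rewrite psumr_eq0 => [/allP f0|I IB]; last by rewrite subr_ge0 phi_le //; exact: fP.
  apply: eq_bigr => I IB; apply: phi_eq => //; first exact: fP.
  have := f0 I (mem_index_enum _); rewrite IB subr_eq0 => /eqP.
  by [].
split.
  exists (fun I => e (g I)); split=> // I IB.
  by apply: simplexI_e; case: (gP _ IB).
move=> y z t Py Pz t0 t1 E.
have EM : t * phi y + (1 - t) * phi z = M.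
  by rewrite -phi_lin -E phi_sum; apply: eq_bigr => I _; rewrite phi_e.
have ly := P_le _ Py; have lz := P_le _ Pz.
(* A proper weighted mean of two values at most [M] equals [M] only if both do. *)
have ey : phi y = M by nra.
have ez : phi z = M by nra.
by rewrite (P_eq y) // (P_eq z).
Qed.

Lemma weight_vertex B (w : 'I_d -> nat) (i0 : 'I_d) : set0 \notin B -> injective w ->
  is_vertex (nestohedron B) (\row_i (deg B [set j | (w j <= w i)%N] i)%:R : 'rV[R]_d).
Proof.
move=> B0 winj.
have /fin_all_exists[g gP] I : exists i, I \in B -> i \in I /\ forall j, j \in I -> (w j <= w i)%N.
  (* [i0] is a dummy value at the empty set, which is not in [B]. *)
  have [->|/set0Pn[i iI]] := eqVneq I set0; first by exists i0; rewrite (negPf B0).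
  by exists [arg max_(k > i in I) w k] => _; case: arg_maxnP.
have -> : \row_i (deg B [set j | (w j <= w i)%N] i)%:R = \sum_(I in B) e (g I).
  apply/rowP => i; rewrite sum_e_E mxE; congr (_%:R); apply: eq_card => I.
  rewrite !inE sub1set; have [IB|//] := boolP (I \in B); have [gI gm] := gP _ IB.
  apply/andP/eqP => [[/subsetP sI iI]|<-].
    by apply/winj/eqP; rewrite eqn_leq gm // andbT; have := sI _ gI; rewrite inE.
  by split=> //; apply/subsetP => j jI; rewrite inE gm.
apply: (maximal_sum_vertex (w := fun i => (w i)%:R)) => I IB.
have [gI gm] := gP _ IB; split=> // i iI ni; rewrite ltr_nat ltn_neqAle gm // andbT.
by apply: contra_neq ni; apply: winj.
Qed.

(** * Every vertex comes from a choice of one element in each member *)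

(** Mass could be moved between [i] and [j] in both directions, making [v] the midpoint of two
    distinct points. *)
Lemma vertex_summand B v (f : {set 'I_d} -> 'rV[R]_d) I i j :
  is_vertex (nestohedron B) v -> (forall I, I \in B -> simplexI I (f I)) ->
  v = \sum_(I in B) f I -> I \in B -> i != j -> 0 < f I 0 i -> 0 < f I 0 j -> False.
Proof.
move=> [_ ext] fP vE IB nij fi fj.
(* The largest amount that can be moved either way without leaving the simplex. *)
pose m := Num.min (f I 0 i) (f I 0 j).
have m0 : 0 < m by rewrite lt_min fi fj.
have [mi mj] : m <= f I 0 i /\ m <= f I 0 j by rewrite !ge_min !lexx orbT.
have /simplexIP[f0 fI f1] := fP _ IB.
have iI : i \in I by apply: contraTT fi => /fI ->; rewrite ltxx.
have jI : j \in I by apply: contraTT fj => /fI ->; rewrite ltxx.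
have shifted a : `|a| <= m -> nestohedron B (v + a *: (e i - e j)).
  move=> am; exists (fun K => if K == I then f I + a *: (e i - e j) else f K); split.
    move=> K KB; case: eqP => [->|_]; last exact: fP.
    have cE k : (f I + a *: (e i - e j)) 0 k = f I 0 k + a * ((i == k)%:R - (j == k)%:R).
      by rewrite -!e_E !mxE.
    apply/simplexIP; split=> [k|k kI|].
    - rewrite cE; have := f0 k; move: am; rewrite ler_norml => /andP[a1 a2].
      have [ik|_] := eqVneq i k; have [jk|_] := eqVneq j k; rewrite ?ik ?jk /= in mi mj nij *.
      + by rewrite eqxx in nij.
      + by lra.
      + by lra.
      + by lra.
    - rewrite cE fI //; case: eqP => [ik|_]; first by rewrite -ik iI in kI.
      by case: eqP => [jk|_]; [rewrite -jk jI in kI|rewrite subrr mulr0 addr0].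
    - transitivity (\sum_k (f I 0 k + a * (e i 0 k - e j 0 k))).
        by apply: eq_bigr => k _; rewrite !mxE.
      by rewrite big_split -mulr_sumr /= sumrB !sum_coord_e f1 subrr mulr0 addr0.
  rewrite vE (bigD1 I) //= [RHS](bigD1 I) //= eqxx addrAC; congr (_ + _).
  by apply: eq_bigr => K /andP[_ /negPf->].
have h2 : 0 < 2^-1 :> R by rewrite invr_gt0.
have h3 : 2^-1 < 1 :> R by lra.
have mm : `|m| <= m by rewrite gtr0_norm.
have mn : `|- m| <= m by rewrite normrN gtr0_norm.
have /rowP/(_ i) : v + m *: (e i - e j) = v + (- m) *: (e i - e j).
  apply: (ext _ _ _ (shifted _ mm) (shifted _ mn) h2 h3).
  by apply/rowP => k; rewrite !mxE; field.
by rewrite !mxE !eqxx (negPf nij) /= subr0 !mulr1 => /addrI/eqP; rewrite eq_sym eqNr gt_eqF.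
Qed.

(** The coordinates of a summand add up to one, so some coordinate is positive, and [vertex_summand]
    makes it the only one. *)
Lemma vertex_sum_e B v : is_vertex (nestohedron B) v -> 'I_d ->
  exists2 g : {set 'I_d} -> 'I_d,
    forall I, I \in B -> g I \in I & v = \sum_(I in B) e (g I).
Proof.
move=> Vv i0; have [[f [fP vE]] _] := Vv.
have /fin_all_exists[g gP] I : exists i, I \in B -> i \in I /\ f I = e i.
  have [IB|] := boolP (I \in B); last by exists i0.
  have /simplexIP[f0 fI f1] := fP _ IB.
  have [i fi] : exists i, 0 < f I 0 i.
    apply/existsP; apply: contra_eqT f1; rewrite negb_exists => /forallP fn.
    rewrite big1 ?oner_neq0 1?eq_sym ?oner_neq0 // => i _.
    by apply/eqP; rewrite eq_le f0 leNgt fn.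
  exists i => _; split; first by apply: contraTT fi => /fI ->; rewrite ltxx.
  have fz j : j != i -> f I 0 j = 0.
    move=> ji; apply/eqP; rewrite eq_le f0 andbT leNgt; apply/negP => fj.
    exact: (vertex_summand Vv fP vE IB ji fj fi).
  apply/rowP => j; rewrite e_E; have [<-|ni] := eqVneq i j.
    by rewrite -f1 (bigD1 i) //= big1 ?addr0.
  by rewrite fz // eq_sym.
exists g => [I /gP[]//|]; rewrite vE; apply: eq_bigr => I /gP[_ ->//].
Qed.

(* Otherwise every [t] in [J] has a predecessor [p t != t]: some member [S t] of
   [B], containing [t], is sent by [g] to [p t].  Moving half of the mass of
   these summands from [p t] to [t] along a set on which [p] is a permutation
   leaves the sum unchanged. *)
Lemma vertex_top B v (g : {set 'I_d} -> 'I_d) J :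
  is_vertex (nestohedron B) v -> (forall I, I \in B -> g I \in I) ->
  v = \sum_(I in B) e (g I) -> J != set0 ->
  exists2 t, t \in J & forall I, I \in B -> I \subset J -> t \in I -> g I = t.
Proof.
move=> Vv gP vE J0.
pose bad t I := [&& I \in B, I \subset J, t \in I & g I != t].
have [/existsP[t /andP[tJ /forallP tP]]|] :=
    boolP [exists t, (t \in J) && [forall I, ~~ bad t I]].
  exists t => // I IB IJ tI; apply/eqP; have := tP I.
  by rewrite /bad IB IJ tI /= negbK.
rewrite negb_exists => /forallP noT.
have /fin_all_exists[S SP] t : exists I, t \in J -> bad t I.
  have [tJ|_] := boolP (t \in J); last by exists set0.
  by have := noT t; rewrite tJ negb_forall => /existsP[I]; rewrite negbK; exists I.
pose p t := g (S t).
have pJ t : t \in J -> p t \in J.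
  by move=> /SP/and4P[SB /subsetP sSJ _ _]; apply/sSJ/gP.
pose stable (C : {set 'I_d}) := (C != set0) && (p @: C \subset C).
have stJ : stable J.
  by rewrite /stable J0; apply/subsetP => _ /imsetP[t tJ ->]; exact: pJ.
(* On a minimal stable set [p] is onto, since the image is again stable; hence [p] permutes [C]. *)
have [C /minsetP[/andP[C0 sC] minC] CJ] := minset_exists stJ.
have pC : p @: C = C.
  apply: minC => //; rewrite /stable imsetS ?andbT //.
  by have [c cC] := set0Pn _ C0; apply/set0Pn; exists (p c); apply: imset_f.
have pinj : {in C &, injective p} by apply/imset_injP; rewrite pC.
have CP t : t \in C -> bad t (S t) by move=> tC; apply: SP; apply: (subsetP CJ).
pose f I := e (g I) + \sum_(t in C | S t == I) 2^-1 *: (e t - e (g I)).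
(* [S] is injective on [C] because [p] is, so each [S t] receives exactly one shift. *)
have fS t : t \in C -> f (S t) = 2^-1 *: (e t + e (p t)).
  move=> tC; rewrite /f (big_pred1 t) => [|u /=].
    by apply/rowP => k; rewrite !mxE; field.
  apply/andP/eqP => [[uC /eqP Su]|->]; last by rewrite tC.
  by apply: pinj => //; rewrite /p Su.
have [c cC] := set0Pn _ C0; have /and4P[SB _ cS gc] := CP _ cC.
have fP I : I \in B -> simplexI I (f I).
  move=> IB; have [/existsP[t /andP[tC /eqP tI]]|] := boolP [exists t, (t \in C) && (S t == I)].
    have /and4P[_ _ tS _] := CP _ tC.
    rewrite -tI fS //; have /simplexIP[a0 aI a1] := simplexI_e tS.
    have /simplexIP[b0 bI b1] := simplexI_e (gP _ (etrans (congr1 (mem B) tI) IB)).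
    apply/simplexIP; split=> [k|k kI|].
    - by rewrite 2!mxE mulr_ge0 ?invr_ge0 ?ler0n // addr_ge0.
    - by rewrite 2!mxE aI ?bI // addr0 mulr0.
    - transitivity (\sum_k 2^-1 * (e t 0 k + e (p t) 0 k)).
        by apply: eq_bigr => k _; rewrite !mxE.
      by rewrite -mulr_sumr big_split /= !sum_coord_e; field.
  rewrite negb_exists => /forallP nI; rewrite /f big_pred0 => [|t]; last exact: negbTE (nI t).
  by rewrite addr0; apply: simplexI_e; exact: gP.
(* The shifts add up to half the sum of [e t - e (p t)] over [C], which vanishes because [p]
   permutes [C]. *)
have fE : v = \sum_(I in B) f I.
  rewrite big_split -vE /= (exchange_big_dep (mem C)) /= => [|I t _ /andP[]//].
  rewrite (eq_bigr (fun t => 2^-1 *: (e t - e (p t)))) => [|t tC]; last first.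
    have /and4P[tB _ _ _] := CP _ tC.
    rewrite (big_pred1 (S t)) // => I /=; rewrite tC /= eq_sym.
    by case: eqP => [->|]; rewrite ?tB ?andbF.
  rewrite -scaler_sumr sumrB -[X in _ - X](big_imset (fun t => e t) pinj) /= pC.
  by rewrite subrr scaler0 addr0.
have fc k : 0 < f (S c) 0 k <-> (k == c) || (k == p c).
  rewrite fS // !mxE !eqxx /=; case: (k == c); case: (k == p c) => /=; split=> //; lra.
by case: (vertex_summand Vv fP fE SB gc); rewrite fc eqxx ?orbT.
Qed.

(** * Distances from a center to the vertices, and the equivalence *)

(** Repeated use of [vertex_top] reads an order off the vertex from the top down, and the distance
    does not depend on that order. *)
Lemma vertex_sqdist B v (c : 'rV[R]_d) : potential B (fun i => c 0 i) ->
  is_vertex (nestohedron B) v ->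
  \sum_i (v 0 i - c 0 i) ^+ 2 = order_sqdist B (fun i => c 0 i) (enum [set: 'I_d]).
Proof.
move=> cP Vv; have [i0 _|noI] := pickP 'I_d; last first.
  suff -> : enum [set: 'I_d] = [::] by rewrite big_pred0.
  by apply: size0nil; rewrite -cardE; apply: eq_card0 => i; have := noI i.
have [g gP vE] := vertex_sum_e Vv i0.
(* Invariant of the peeling: members not inside [J] are sent outside [J], so the coordinates in [J]
   see only the members inside [J]. *)
suff sJ J : (forall I, I \in B -> ~~ (I \subset J) -> g I \notin J) ->
    \sum_(i in J) (v 0 i - c 0 i) ^+ 2 = order_sqdist B (fun i => c 0 i) (enum J).
  rewrite -sJ => [|I _]; last by rewrite subsetT.
  by apply: eq_bigl => i; rewrite inE.
have [n] := ubnP #|J|; elim: n J => // n IH J leJ gJ.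
have [->|J0] := eqVneq J set0; first by rewrite big_set0 enum_set0.
have [t tJ tP] := vertex_top Vv gP vE J0.
rewrite (order_sqdist_peel cP tJ) (big_setD1 t tJ) -IH /=.
- congr ((_ - _) ^+ 2 + _); rewrite vE sum_e_E; congr (_%:R); apply: eq_card => I.
  rewrite !inE sub1set -andbA; have [IB|//] := boolP (I \in B). rewrite /=.
  apply/eqP/andP => [gt|[IJ tI]]; last exact: tP.
  by split; [apply: contraTT tJ => /(gJ _ IB); rewrite gt|rewrite -gt gP].
- by rewrite -ltnS (leq_trans _ leJ) // ltnS [X in (_ < X)%N](cardsD1 t) tJ.
- move=> I IB; rewrite subsetD1 negb_and negbK inE negb_and negbK inE => nI.
  have [IJ|/(gJ _ IB)->] := boolP (I \subset J); last by rewrite orbT.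
  by move: nI; rewrite IJ /= => tI; rewrite (tP I) ?eqxx.
Qed.

Lemma inscribed_potential B : set0 \notin B ->
  inscribed (@nestohedron R d B) -> exists c : 'I_d -> R, potential B c.
Proof.
move=> B0 [c [rho cP]]; exists (fun i => c 0 i) => J i j iJ jJ nij n0.
(* For [a], [b] in [J] the order puts the rest of [J] lowest (below [d]), then [b], then [a], then
   everything outside [J] (from [d.+2] on). [w i j] and [w j i] differ by one adjacent exchange. *)
pose w (a b y : 'I_d) : nat := if y == a then d.+1 else if y == b then d
  else if y \in J then nat_of_ord y else (d.+2 + y)%N.
have winj a b : a != b -> injective (w a b).
  move=> nab y z; rewrite /w; have := ltn_ord y; have := ltn_ord z => lz ly.
  case: (eqVneq y a) => [ya|_]; case: (eqVneq z a) => [za|_];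
  case: (eqVneq y b) => [yb|_]; case: (eqVneq z b) => [zb|_];
  case: (y \in J); case: (z \in J) => /= h;
  first [congruence | exfalso; lia | apply: val_inj => /=; lia].
have down1 a b : a \in J -> b \in J -> [set y | (w a b y <= w a b a)%N] = J.
  move=> aJ bJ; apply/setP => y; rewrite !inE /w eqxx; have := ltn_ord y.
  by case: (eqVneq y a) => [->|_]; rewrite ?aJ ?leqnn //; case: (eqVneq y b) => [->|_];
    rewrite ?bJ //; case: (y \in J) => ?; lia.
have down2 a b : a != b -> a \in J -> b \in J -> [set y | (w a b y <= w a b b)%N] = J :\ a.
  move=> nab aJ bJ; apply/setP => y; rewrite !inE /w eqxx [b == a]eq_sym (negPf nab).
  have := ltn_ord y; case: (eqVneq y a) => [->|_] /=; first by move=> _; lia.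
  by case: (eqVneq y b) => [->|_]; rewrite ?bJ ?leqnn //; case: (y \in J) => ?; lia.
have down3 (y : 'I_d) : y != i -> y != j ->
    [set z | (w i j z <= w i j y)%N] = [set z | (w j i z <= w j i y)%N].
  move=> yi yj; apply/setP => z; rewrite !inE /w (negPf yi) (negPf yj).
  have := ltn_ord y; have := ltn_ord z.
  by case: (z == i); case: (z == j); case: (y \in J) => // *; lia.
have nji : j != i by rewrite eq_sym.
have split2 (F : 'I_d -> R) :
    \sum_k F k = F i + F j + \sum_(k | (k != i) && (k != j)) F k.
  by rewrite (bigD1 i) //= (bigD1 j) //= addrA.
have := cP _ (weight_vertex i B0 (winj _ _ nij)).
rewrite -(cP _ (weight_vertex i B0 (winj _ _ nji))).
rewrite !split2 !mxE.
rewrite !down1 // !down2 //.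
set s1 := \sum_(k | _) _; set s2 := \sum_(k | _) _.
have -> : s1 = s2.
  by apply: eq_bigr => k /andP[ki kj]; rewrite !mxE down3.
have := swap_sqr B (fun k => c 0 k) J i j => sw eqs.
(* The two vertices are equidistant from [c] and agree outside [i] and [j], so the left side of
   [swap_sqr] vanishes. *)
have : 2 * (nsup B J [set i; j])%:R * ((deg B J i)%:R - (deg B J j)%:R - (c 0 i - c 0 j)) = 0.
  by rewrite -sw; move: eqs; lra.
move/eqP; rewrite mulf_eq0 mulf_eq0 pnatr_eq0 /= pnatr_eq0 -(negbK (nsup _ _ _ == 0)%N).
by rewrite -lt0n n0 subr_eq0 => /eqP.
Qed.

End Vertices.

Theorem theorem4p19 (R : realType) (d : nat) (B : {set {set 'I_d}}) :
  building_set B ->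
  (inscribed (@nestohedron R d B) <->
   forall (J : {set 'I_d}) (i j k : 'I_d),
     i \in J -> j \in J -> k \in J ->
     (0 < ncount (restrict B J) i j k)%N ->
     (0 < ncount (restrict B J) j k i)%N ->
     ncount (restrict B J) i j k = ncount (restrict B J) j k i /\
     ncount (restrict B J) j k i = ncount (restrict B J) i k j).
Proof.
case=> B0 _; split=> [/(inscribed_potential B0)[c]|bal].
  exact: potential_balanced.
pose c : 'rV[R]_d := \row_i (deg B setT i)%:R.
(* The squared radius is computed along the enumeration order; any other order gives the same
   value. *)
exists c, (order_sqdist B (fun i => c 0 i) (enum [set: 'I_d])) => v.
apply: vertex_sqdist => J i j iJ jJ nij n0; rewrite !mxE.
exact: (balanced_potential R bal iJ jJ nij n0).
Qed.
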